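(* Let $E\subset\mathbb R^n$ be the attractor of an iterated function system without rotations, $S_i(x)=\lambda_ix+d_i$ ($i=1,\dots,l$, $\lambda_i\in(0,1)$, $d_i\in\mathbb R^n$), satisfying the open set condition, and suppose that $E$ satisfies the slice coding condition. Let $s$ be the Hausdorff dimension of $E$, and let $\theta$ be such that the projection $\nu_\theta$ of the $s$-dimensional Hausdorff measure on $E$ onto the line $l_\theta$ at angle $\theta$ through the origin is absolutely continuous with bounded density. Then $\mathcal H^{s-1}(E_{\theta,x})>0$ for $\nu_\theta$-almost every $x\in\pi_\theta(E)$.
   Context: The attractor $E$ is the nonempty compact set with $E=\bigcup_{i=1}^lS_i(E)$. Open set condition: there is a nonempty open $V\subset\mathbb R^n$ with $V\supset\bigcup_{i=1}^lS_i(V)$, the union being disjoint. The Hausdorff dimension $s$ of $E$ then satisfies $\sum_{i=1}^l\lambda_i^s=1$, and $\nu=\mathcal H^s|_E$ is positive and finite. $\theta=(\theta_1,\dots,\theta_{n-1})$ denotes angles determining a line $l_\theta$ through the origin in $\mathbb R^n$; $\pi_\theta$ is orthogonal projection of $\mathbb R^n$ onto $l_\theta$, with $l_\theta$ identified with $\mathbb R$; $\nu_\theta=\nu\circ\pi_\theta^{-1}$; absolute continuity is with respect to one-dimensional Lebesgue measure, and bounded means essentially bounded. For $x\in\pi_\theta(E)$, the slice $E_{\theta,x}=E\cap\pi_\theta^{-1}(x)$ is the intersection of $E$ with the $(n-1)$-dimensional plane perpendicular to $l_\theta$ through $x$. $|A|$ denotes Euclidean diameter. Slice coding condition: for all $\theta$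 there exists a constant $\delta>0$ such that for all $x\in\pi_\theta(E)$ either $|E_{\theta,x}|>\delta$ or $E_{\theta,x}\subset S_a(E)$ for some $a\in\{1,\dots,l\}$. *)

(* Defs.v *)
From HB Require Import structures.
From mathcomp Require Import all_boot all_order all_algebra.
From mathcomp Require Import all_classical all_reals all_analysis ess_sup_inf.
Set Implicit Arguments.
Unset Strict Implicit.
Unset Printing Implicit Defensive.
Import Order.TTheory GRing.Theory Num.Theory.
Import numFieldNormedType.Exports.
Local Open Scope classical_set_scope.
Local Open Scope ring_scope.

Section Euclidean.
Context {R : realType} {m : nat}.
Implicit Types (x y : 'rV[R]_m) (A : set 'rV[R]_m).

Definition dotp x y : R := \sum_i x 0 i * y 0 i.

(* The library norm on 'rV[R]_m is the sup norm, which defines the same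
   topology but a different diameter, hence the separate Euclidean norm. *)
Definition enorm x : R := Num.sqrt (dotp x x).

(* ediam set0 = -oo *)
Definition ediam A : \bar R :=
  ereal_sup [set (enorm (p.1 - p.2))%:E | p in A `*` A].

(* |A|^t, with |set0|^t = 0 and |{x}|^0 = 1 (so that H^0 is the counting
   measure). *)
Definition ediam_pow (t : R) A : \bar R :=
  if A == set0 then 0%E else (ediam A `^ t)%E.

Definition hausdorff_pre (t delta : R) A : \bar R :=
  ereal_inf [set (\sum_(0 <= k <oo) ediam_pow t (U k))%E
            | U in [set U : (set 'rV[R]_m)^nat |
                     A `<=` \bigcup_k U k /\
                     forall k, (ediam (U k) <= delta%:E)%E]].

(* Only meaningful for 0 <= t. *)
Definition hausdorff_measure (t : R) A : \bar R :=
  ereal_sup [set hausdorff_pre t delta A | delta in [set delta : R | 0 < delta]].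

Definition hausdorff_dim A : \bar R :=
  ereal_inf [set t%:E | t in [set t : R | 0 <= t /\ hausdorff_measure t A = 0%E]].

End Euclidean.

Section IFS.
Context {R : realType} {m l : nat}.
Variables (lambda : 'I_l -> R) (d : 'I_l -> 'rV[R]_m).

Definition ifs_map (i : 'I_l) (x : 'rV[R]_m) : 'rV[R]_m := lambda i *: x + d i.

Definition open_set_condition : Prop :=
  exists V : set 'rV[R]_m, [/\ V !=set0, open V,
    \bigcup_i (ifs_map i @` V) `<=` V &
    trivIset setT (fun i => ifs_map i @` V)].

Definition is_attractor (E : set 'rV[R]_m) : Prop :=
  [/\ E !=set0, compact E & E = \bigcup_i (ifs_map i @` E)].

End IFS.

Section Slices.
Context {R : realType} {n : nat}.
Implicit Types (theta : 'rV[R]_n) (E : set 'rV[R]_n.+1).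

(* Spherical coordinates: the unit vector
   (cos t_1, sin t_1 cos t_2, ..., sin t_1 ... sin t_(n-1) cos t_n,
    sin t_1 ... sin t_n) of R^(n+1), which spans the line l_theta. *)
Definition direction theta : 'rV[R]_n.+1 :=
  \row_i ((\prod_(j < n | (j < i)%N) sin (theta 0 j)) *
          (if unlift ord_max i is Some j then cos (theta 0 j) else 1)).

(* Orthogonal projection onto l_theta, with l_theta identified with R via
   a |-> a *: direction theta. *)
Definition line_proj theta (x : 'rV[R]_n.+1) : R := dotp x (direction theta).

Definition slice E theta (x : R) : set 'rV[R]_n.+1 :=
  E `&` line_proj theta @^-1` [set x].

Definition slice_coding_condition (l : nat) (lambda : 'I_l -> R)
    (d : 'I_l -> 'rV[R]_n.+1) E : Prop :=
  forall theta, exists2 delta : R, 0 < delta &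
    forall x, (line_proj theta @` E) x ->
      (delta%:E < ediam (slice E theta x))%E \/
      exists a : 'I_l, slice E theta x `<=` ifs_map lambda d a @` E.

Definition hausdorff_restr (s : R) E (A : set 'rV[R]_n.+1) : \bar R :=
  hausdorff_measure s (E `&` A).

Definition proj_measure (s : R) E theta (B : set (measurableTypeR R)) : \bar R :=
  hausdorff_restr s E (line_proj theta @^-1` B).

End Slices.

Definition has_bounded_density {R : realType}
    (mu : set (measurableTypeR R) -> \bar R) : Prop :=
  exists f : measurableTypeR R -> R,
    [/\ measurable_fun setT f, forall x, 0 <= f x,
        (ess_sup lebesgue_measure (EFin \o f) < +oo)%E &
        forall B, measurable B ->
          mu B = (\int[lebesgue_measure]_(x in B) (f x)%:E)%E].

(* Main.v *)
Require Import Defs.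
From HB Require Import structures.
From mathcomp Require Import all_boot all_order all_algebra.
From mathcomp Require Import all_classical all_reals all_analysis.
From mathcomp Require Import measurable_realfun ess_sup_inf.
From mathcomp Require Import ring lra.
Set Implicit Arguments.
Unset Strict Implicit.
Unset Printing Implicit Defensive.
Import Order.TTheory GRing.Theory Num.Theory.
Import numFieldNormedType.Exports.
Local Open Scope classical_set_scope.
Local Open Scope ring_scope.

(** Write [nu] for the [s]-dimensional Hausdorff measure on [E], [f] for the
density of its projection [nu_theta], and [M] for an essential bound of [f].
The point is that a slice of zero [(s-1)]-dimensional measure forces [nu_theta]
to be thin around its base point.

Rescaling by a homothety of ratio [c] multiplies [nu] by [c^s] and shrinks a
strip of half-width [r] from one of half-width [r/c]; since [nu_theta] has
density at most [M], a copy of [E] of ratio [c] carries at most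
[c^s * 2M * (r/c) = 2M * c^(s-1) * r] of its mass in such a strip
([hausdorff_strip_homothety_le]).  By the open set condition, [E] meets a ball
of radius [rho] in boundedly many copies of [E] of ratio at most [rho]
([ball_meets_boundedly_many]), so the part of a strip inside such a ball has
mass at most [C * rho^(s-1) * r] ([hausdorff_ball_strip_le]).

Suppose now that the slice over [x] is null for the [(s-1)]-dimensional
measure.  Cover it by open balls with [sum rho_k^(s-1) <= e].  As [E] is
compact, these balls also cover the slices over all points close to [x], hence
the whole strip of [E] over [ball x r] for small [r]; summing the previous
bound gives [nu_theta (ball x r) <= C * e * r] ([null_slice_small_ratio]).  If
moreover [x] is a Lebesgue point of [f], then [f x = 0] ([lebesgue_pt_eq0]).
Almost every [x] is a Lebesgue point, and [nu_theta] does not charge the zero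
set of [f], so [nu_theta]-almost no slice is null.

This needs [1 <= s], so that [c^(s-1)] is monotone in [c].  If [s < 1], then [E]
has zero [t]-dimensional measure for some [t < 1], its projection is
Lebesgue-null ([hausdorff_null_line_proj]), and [nu_theta] vanishes on it. *)

(** * Hausdorff measures are outer measures *)
Section HausdorffOuterMeasure.
Context {R : realType} {m : nat}.
Implicit Types (t delta c : R) (A B U : set 'rV[R]_m) (x y v : 'rV[R]_m).
Local Open Scope ereal_scope.

Lemma ediam_pow_ge0 t U : 0 <= ediam_pow t U.
Proof. by rewrite /ediam_pow; case: ifP => // _; exact: poweR_ge0. Qed.

Lemma hausdorff_pre_ge0 t delta A : 0 <= hausdorff_pre t delta A.
Proof.
apply: le_ereal_inf_tmp => _ [U _ <-].
by apply: nneseries_ge0 => k _ _; exact: ediam_pow_ge0.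
Qed.

Lemma hausdorff_measure_ge0 t A : 0 <= hausdorff_measure t A.
Proof.
apply: le_trans (hausdorff_pre_ge0 t 1 A) _.
by apply: ereal_sup_ubound; exists 1%R => //=.
Qed.

Lemma hausdorff_pre_le_measure t delta A : (0 < delta)%R ->
  hausdorff_pre t delta A <= hausdorff_measure t A.
Proof. by move=> d0; apply: ereal_sup_ubound; exists delta. Qed.

Lemma le_hausdorff_measure t A B :
  A `<=` B -> hausdorff_measure t A <= hausdorff_measure t B.
Proof.
move=> AB; apply: ge_ereal_sup => _ [delta /= d0 <-].
apply: le_trans (hausdorff_pre_le_measure t B d0).
apply: le_ereal_inf_tmp => _ [U [BU Ud] <-].
by apply: ereal_inf_lbound; exists U => //; split => //; exact: subset_trans BU.
Qed.

Lemma ediam_set0 : ediam (@set0 'rV[R]_m) = -oo.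
Proof. by rewrite /ediam setX0 image_set0 ereal_sup0. Qed.

Lemma hausdorff_measure0 t : hausdorff_measure t (@set0 'rV[R]_m) = 0.
Proof.
apply/eqP; rewrite eq_le hausdorff_measure_ge0 andbT.
apply: ge_ereal_sup => _ [delta /= d0 <-]; apply: ereal_inf_lbound.
exists (fun=> set0); first by split=> // k; rewrite ediam_set0 leNye.
by apply: eseries0 => k _ _; rewrite /ediam_pow eqxx.
Qed.

(* The size [hausdorff_pre] is the outer measure generated by the set function
   below, for the trivial structure in which every set is measurable: an
   infinite price on large sets enforces the bound on the diameters. *)
Let DT := g_sigma_algebraType [set: set 'rV[R]_m].

Let gauge t delta (U : set DT) : \bar R :=
  if ediam (U : set 'rV[R]_m) <= delta%:E then ediam_pow t U else +oo.

Let gauge_ge0 t delta (U : set DT) : 0 <= gauge t delta U.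
Proof. by rewrite /gauge; case: ifP => // _; exact: ediam_pow_ge0. Qed.

Let hausdorff_pre_mu_ext t delta : hausdorff_pre t delta = mu_ext (gauge t delta).
Proof.
apply/funext => A; apply/eqP; rewrite eq_le; apply/andP; split.
- apply: le_ereal_inf_tmp => _ [U [_ AU] <-].
  have [Ud|/existsNP[k Uk]] := pselect (forall k, ediam (U k) <= delta%:E).
    apply: ereal_inf_lbound; exists U; first by split.
    by apply: eq_eseriesr => k _; rewrite /gauge Ud.
  rewrite (eseries_pinfty _ (k := k)) ?leey//.
    by move=> i _ ; rewrite gt_eqF// (lt_le_trans _ (gauge_ge0 _ _ _))// ltNy0.
  by rewrite /gauge; move/negP/negbTE: Uk => ->.
- apply: le_ereal_inf_tmp => _ [U [AU Ud] <-].
  apply: ereal_inf_lbound; exists U.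
    by split => // k; apply: sub_sigma_algebra.
  by apply: eq_eseriesr => k _; rewrite /gauge Ud.
Qed.

Lemma hausdorff_measure_sigma_subadditive t :
  sigma_subadditive (hausdorff_measure t : set 'rV[R]_m -> _).
Proof.
move=> F; apply: ge_ereal_sup => _ [delta /= d0 <-].
rewrite hausdorff_pre_mu_ext.
apply: le_trans (mu_ext_sigma_subadditive (gauge_ge0 t delta) F) _.
apply: lee_nneseries => k _.
  by rewrite -hausdorff_pre_mu_ext hausdorff_pre_ge0.
by rewrite -hausdorff_pre_mu_ext hausdorff_pre_le_measure.
Qed.

HB.instance Definition _ t := isOuterMeasure.Build R 'rV[R]_m
  (hausdorff_measure t) (hausdorff_measure0 t) (hausdorff_measure_ge0 t)
  (@le_hausdorff_measure t) (hausdorff_measure_sigma_subadditive t).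

End HausdorffOuterMeasure.

(** * Euclidean norm and diameter *)
Section EuclideanNorm.
Context {R : realType} {m : nat}.
Implicit Types (c : R) (U : set 'rV[R]_m) (x y v : 'rV[R]_m).

Lemma enorm_ge0 x : 0 <= enorm x.
Proof. exact: sqrtr_ge0. Qed.

Lemma enorm_scale c x : 0 <= c -> enorm (c *: x) = c * enorm x.
Proof.
move=> c0; rewrite /enorm.
have -> : dotp (c *: x) (c *: x) = c ^+ 2 * dotp x x.
  rewrite /dotp mulr_sumr; apply: eq_bigr => i _.
  by rewrite !mxE mulrACA -expr2.
by rewrite sqrtrM ?sqr_ge0// sqrtr_sqr ger0_norm.
Qed.

Lemma coord_le_enorm x j : `|x 0 j| <= enorm x.
Proof.
rewrite -sqrtr_sqr /enorm ler_sqrt; last first.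
  by apply: sumr_ge0 => i _; rewrite -expr2 sqr_ge0.
rewrite /dotp (bigD1 j)//= expr2 lerDl.
by apply: sumr_ge0 => i _; rewrite -expr2 sqr_ge0.
Qed.

Lemma enorm_le_ediam U x y : U x -> U y -> ((enorm (x - y))%:E <= ediam U)%E.
Proof. by move=> Ux Uy; apply: ereal_sup_ubound; exists (x, y). Qed.

Lemma ediam_ge0 U : U !=set0 -> (0 <= ediam U)%E.
Proof.
move=> [x Ux]; apply: le_trans (enorm_le_ediam Ux Ux).
by rewrite lee_fin enorm_ge0.
Qed.

(** Balls of row vectors are cubes; the proof only ever uses coordinatewise
bounds, and by [coord_le_enorm] these follow from Euclidean ones. *)
Lemma rV_ballP x c y : 0 < c ->
  ball x c y <-> forall j, `|x 0 j - y 0 j| < c.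
Proof.
move=> c0; split=> [[_ h] j|h]; first exact: h.
by split=> // i j; rewrite ord1; exact: h.
Qed.

End EuclideanNorm.

(** * Scaling of Hausdorff measures under homotheties *)
Section HomothetyScaling.
Context {R : realType} {m : nat}.
Implicit Types (t delta : R) (A U : set 'rV[R]_m) (p : R * 'rV[R]_m).

(** A homothety is encoded by its ratio and translation part, so that the ratio
of a composite can be read off and homotheties can be compared for equality. *)
Definition homothety p (x : 'rV[R]_m) := p.1 *: x + p.2.

Lemma homothetyB p x y : homothety p x - homothety p y = p.1 *: (x - y).
Proof. by rewrite /homothety opprD addrACA subrr addr0 scalerBr. Qed.

Local Open Scope ereal_scope.

Lemma ediam_homothety_le p U : (0 < p.1)%R ->
  ediam (homothety p @` U) <= p.1%:E * ediam U.
Proof.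
move=> c0; apply: ge_ereal_sup => _ [[_ _] [/= [x Ux <-] [y Uy <-]] <-].
rewrite homothetyB (enorm_scale _ (ltW c0)) EFinM.
by apply: lee_wpmul2l; [rewrite lee_fin ltW|exact: enorm_le_ediam].
Qed.

Lemma ediam_pow_homothety_le t p U : (0 < p.1)%R -> (0 <= t)%R ->
  ediam_pow t (homothety p @` U) <= (p.1 `^ t)%:E * ediam_pow t U.
Proof.
move=> c0 t0; have [->|/set0P U0] := eqVneq U set0.
  by rewrite image_set0 /ediam_pow eqxx mule0.
have U0' : homothety p @` U !=set0 by case: U0 => x Ux; exists (homothety p x), x.
rewrite /ediam_pow !ifN; [|exact/set0P..].
have c0' : 0 <= p.1%:E by rewrite lee_fin ltW.
rewrite -poweR_EFin -(poweRM _ c0' (ediam_ge0 U0)).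
apply: gt0_ler_poweR => //; last exact: ediam_homothety_le.
- by rewrite in_itv/= ediam_ge0//= leey.
- by rewrite in_itv/= mule_ge0 ?ediam_ge0//= leey.
Qed.

Lemma hausdorff_measure_homothety_le t p A : (0 < p.1)%R -> (0 <= t)%R ->
  hausdorff_measure t (homothety p @` A) <= (p.1 `^ t)%:E * hausdorff_measure t A.
Proof.
move=> c0 t0; apply: ge_ereal_sup => _ [delta /= d0 <-].
have d0' : (0 < delta / p.1)%R by rewrite divr_gt0.
apply: (@le_trans _ _ ((p.1 `^ t)%:E * hausdorff_pre t (delta / p.1) A)); last first.
  by apply: lee_wpmul2l; [rewrite lee_fin powR_ge0|exact: hausdorff_pre_le_measure].
rewrite -ereal_inf_pZl ?powR_gt0//.
apply: le_ereal_inf_tmp => _ [_ [U [AU Ud] <-] <-].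
rewrite -nneseriesZl; last by move=> *; exact: ediam_pow_ge0.
apply: (@le_trans _ _ (\sum_(0 <= k <oo) ediam_pow t (homothety p @` U k))).
  apply: ereal_inf_lbound; exists (fun k => homothety p @` U k) => //; split.
    by move=> _ [x /AU[k _ Ukx] <-]; exists k => //; exists x.
  move=> k; apply: le_trans (ediam_homothety_le _ c0) _.
  by rewrite -lee_pdivlMl// -EFinM mulrC Ud.
by apply: lee_nneseries => k *; [exact: ediam_pow_ge0|exact: ediam_pow_homothety_le].
Qed.

End HomothetyScaling.

(** * Covers of sets of zero Hausdorff measure *)
Section NullSets.
Context {R : realType} {m : nat}.
Implicit Types (t delta : R) (A U : set 'rV[R]_m).

Lemma hausdorff_null_cover t A : hausdorff_measure t A = 0%E ->
  forall e : R, 0 < e -> exists U : (set 'rV[R]_m)^nat,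
    [/\ A `<=` \bigcup_k U k, forall k, (ediam (U k) <= 1%:E)%E &
        (\sum_(0 <= k <oo) ediam_pow t (U k) < e%:E)%E].
Proof.
move=> A0 e e0.
have : (hausdorff_pre t 1 A < e%:E)%E.
  by apply: le_lt_trans (hausdorff_pre_le_measure t A ltr01) _; rewrite A0 lte_fin.
move/ereal_inf_lt => [_ [U [AU Ud] <-] Ue].
by exists U; split.
Qed.

(** Every nonempty set of a cover costs [1] in exponent [0]. *)
Lemma hausdorff_measure_exp0_eq0 A : hausdorff_measure 0 A = 0%E -> A = set0.
Proof.
move=> /hausdorff_null_cover /(_ 1 ltr01)[U [AU Ud]]; rewrite ltNge => /negP U1.
rewrite -subset0 => x /AU[k _ Ukx]; apply: U1.
apply: le_trans (nneseries_lim_ge k.+1 _); last by move=> *; exact: ediam_pow_ge0.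
rewrite big_nat_recr//= -[leLHS]add0e; apply: leeD.
  by apply: sume_ge0 => *; exact: ediam_pow_ge0.
rewrite /ediam_pow ifF ?poweRe0//.
by apply/eqP => Uk0; rewrite Uk0 in Ukx.
Qed.

(** The sets of an efficient cover may be points, which lie in no ball of their
own size.  As [0 < t], adding [h / 2^(k+1)] to the cost of the [k]-th set gives
room for a strictly larger radius, at a total extra cost of [h]. *)
Lemma hausdorff_null_ball_cover t A : 0 < t -> hausdorff_measure t A = 0%E ->
  forall e : R, 0 < e -> exists (u : nat -> 'rV[R]_m) (rho : nat -> R),
    [/\ forall k, 0 < rho k <= 1, A `<=` \bigcup_k ball (u k) (rho k) &
        (\sum_(0 <= k <oo) (rho k `^ t)%:E <= e%:E)%E].
Proof.
move=> t0 A0 e e0.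
(* The minimum with [1] makes every single cost, hence every radius, at most
   [1]. *)
pose h : R := Num.min e 1 / 2.
have h0 : 0 < h by rewrite divr_gt0// lt_min e0 ltr01.
have [U [AU Ud Uh]] := hausdorff_null_cover A0 h0.
have fin k : ediam_pow t (U k) \is a fin_num.
  rewrite /ediam_pow; case: ifPn => // /set0P Uk0.
  have := ediam_ge0 Uk0; have := Ud k.
  by case: (ediam (U k)).
pose b k : R := fine (ediam_pow t (U k)) + h / (2 ^ k.+1)%:R.
have b0 k : 0 < b k.
  apply: ltr_wpDl; first by rewrite fine_ge0// ediam_pow_ge0.
  by rewrite divr_gt0// ltr0n expn_gt0.
pose rho k := b k `^ t^-1.
have rhot k : rho k `^ t = b k.
  by rewrite /rho -powRrM mulVf ?gt_eqF// powRr1 ?ltW.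
have sumb : (\sum_(0 <= k <oo) (b k)%:E <= (Num.min e 1)%:E)%E.
  under eq_eseriesr => k _ do rewrite /b EFinD fineK//.
  apply: le_trans (epsilon_trick _ _ (ltW h0)) _.
    by move=> *; exact: ediam_pow_ge0.
  have -> : Num.min e 1 = h + h by rewrite /h -splitr.
  by rewrite EFinD leeD2r// ltW.
have blt k : b k <= 1.
  rewrite -lee_fin; apply: (@le_trans _ _ (Num.min e 1)%:E).
    apply: le_trans sumb.
    apply: le_trans (nneseries_lim_ge k.+1 _).
      rewrite big_nat_recr//= -[leLHS]add0e leeD2r//.
      by apply: sume_ge0 => i _; rewrite lee_fin ltW.
    by move=> i _; rewrite lee_fin ltW.
  by rewrite lee_fin ge_min lexx orbT.
have [u uU] : {u : nat -> 'rV[R]_m & forall k, U k !=set0 -> U k (u k)}.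
  apply: (@choice _ _ (fun k x => U k !=set0 -> U k x)) => k.
  have [[x Ukx]|h'] := pselect (U k !=set0); first by exists x.
  by exists 0 => /h'.
exists u, rho; split.
- move=> k; rewrite powR_gt0//=.
  have <- : 1 `^ t^-1 = 1 :> R by rewrite powR1.
  by apply: ge0_ler_powR; rewrite ?nnegrE ?invr_ge0 ?(ltW t0)// ltW.
- move=> x /AU[k _ Ukx]; exists k => //.
  have Uk0 : U k !=set0 by exists x.
  apply/rV_ballP; first exact: powR_gt0.
  move=> j; have := coord_le_enorm (u k - x) j; rewrite !mxE => /le_lt_trans; apply.
  have dE := enorm_le_ediam (uU _ Uk0) Ukx.
  have dge0 := ediam_ge0 Uk0.
  have : (ediam_pow t (U k) < (b k)%:E)%E.
    rewrite /b EFinD fineK// lteDl// lte_fin divr_gt0// ltr0n expn_gt0//.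
  rewrite /ediam_pow ifF; last by apply/eqP => Uke; rewrite Uke in Ukx.
  have := Ud k; case: (ediam (U k)) dE dge0 => // r.
  rewrite !lee_fin => dr r0 _; rewrite poweR_EFin lte_fin => rb.
  apply: le_lt_trans dr _.
  rewrite ltNge; apply/negP => rhor; move: rb; rewrite ltNge => /negP; apply.
  by rewrite -rhot; apply: ge0_ler_powR; rewrite ?nnegrE ?powR_ge0// ltW.
- under eq_eseriesr => k _ do rewrite rhot.
  by apply: le_trans sumb _; rewrite lee_fin ge_min lexx.
Qed.

End NullSets.

(** * Cylinders of comparable size *)
Section StoppedCylinders.
Context {R : realType} {m l : nat}.
Variables (lambda : 'I_l -> R) (d : 'I_l -> 'rV[R]_m).
Hypothesis hlambda : forall i, 0 < lambda i < 1.
Implicit Types (rho : R) (p q : R * 'rV[R]_m) (E V : set 'rV[R]_m).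

(** [stopped rho] holds of the composites [S_i1 o ... o S_ik] for the words at
which the ratio first drops to [rho] or below.  Peeling off the first letter
[i] turns the threshold [rho] into [rho / lambda i], so the words themselves
need not be mentioned. *)
Inductive stopped : R -> R * 'rV[R]_m -> Prop :=
| stopped_id rho : 1 <= rho -> stopped rho (1, 0)
| stopped_comp rho i p : rho < 1 -> stopped (rho / lambda i) p ->
    stopped rho (lambda i * p.1, lambda i *: p.2 + d i).

Let lambda_gt0 i : 0 < lambda i. Proof. by have /andP[] := hlambda i. Qed.

Lemma homothety_comp i p x :
  homothety (lambda i * p.1, lambda i *: p.2 + d i) x =
  ifs_map lambda d i (homothety p x).
Proof. by rewrite /homothety /ifs_map/= scalerDr scalerA addrA. Qed.

Lemma homothety_id (x : 'rV[R]_m) : homothety (1, 0) x = x.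
Proof. by rewrite /homothety/= scale1r addr0. Qed.

Lemma ifs_map_inj i : injective (ifs_map lambda d i).
Proof.
move=> x y /addIr /(congr1 (fun z => (lambda i)^-1 *: z)).
by rewrite !scalerA mulVf ?gt_eqF// !scale1r.
Qed.

Lemma stopped_gt0 rho p : stopped rho p -> 0 < p.1.
Proof. by elim=> //= *; rewrite mulr_gt0. Qed.

Lemma stopped_le rho p : stopped rho p -> p.1 <= rho.
Proof.
elim=> //= {}rho i {}p _ _; rewrite ler_pdivlMr ?lambda_gt0//.
by rewrite mulrC.
Qed.

(** The ratio was above [rho] one letter earlier.  The condition [a * rho <= 1]
allows for the empty word, of ratio [1]. *)
Lemma stopped_ge (a rho : R) p : 0 < a -> (forall i, a <= lambda i) ->
  stopped rho p -> a * rho <= 1 -> a * rho <= p.1.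
Proof.
move=> a0 al; elim=> //= {}rho i {}p rho1 sp IH _.
have [rho0|rho0] := leP rho 0.
  apply: (@le_trans _ _ 0); first by rewrite mulr_ge0_le0 // ltW.
  by rewrite ltW// mulr_gt0// (stopped_gt0 sp).
have h : a * (rho / lambda i) <= 1.
  rewrite mulrA ler_pdivrMr// mul1r; apply: le_trans (al i).
  by rewrite -[leRHS]mulr1 ler_pM2l// ltW.
have := IH h; rewrite mulrA ler_pdivrMr//.
by rewrite [_ * lambda i]mulrC.
Qed.

Lemma stopped_sub V rho p :
  \bigcup_i (ifs_map lambda d i @` V) `<=` V ->
  stopped rho p -> homothety p @` V `<=` V.
Proof.
move=> VV; elim=> [{}rho _|{}rho i {}p _ _ IH] _ [x Vx <-].
  by rewrite homothety_id.
rewrite homothety_comp; apply: VV; exists i => //; exists (homothety p x) => //.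
by apply: IH; exists x.
Qed.

(** No stopped word is a proper prefix of another one, so two distinct stopped
words first differ at some letter, and there the open set condition separates
them. *)
Lemma stopped_disjoint V rho p q z :
  \bigcup_i (ifs_map lambda d i @` V) `<=` V ->
  trivIset setT (fun i => ifs_map lambda d i @` V) ->
  stopped rho p -> stopped rho q ->
  (homothety p @` V) z -> (homothety q @` V) z -> p = q.
Proof.
move=> VV Vtriv sp; elim: sp q z => [{}rho rho1|{}rho i {}p rho1 sp IH] q z sq.
  case: sq rho1 => // rho' j q' rho'1 _ /le_lt_trans/(_ rho'1).
  by rewrite ltxx.
case: sq rho1 sp IH => [rho'|rho' j q' _ sq'] rho'1.
  by move=> /(le_lt_trans rho'1); rewrite ltxx.
move=> sp IH [x Vx <-] [y Vy]; rewrite !homothety_comp => xy.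
have Vpx : V (homothety p x) by apply: (stopped_sub VV sp); exists x.
have Vqy : V (homothety q' y) by apply: (stopped_sub VV sq'); exists y.
have ij : i = j.
  apply: Vtriv => //; exists (ifs_map lambda d i (homothety p x)); split.
    by exists (homothety p x).
  by exists (homothety q' y).
rewrite -ij in xy sq' *.
have pxqy := ifs_map_inj xy.
rewrite (IH q' (homothety p x) sq')//.
by exists y.
Qed.

(** Following the address of a point of [E], ratios decay geometrically, at rate
[b]; the induction is on a number of letters sufficient for stopping. *)
Lemma stopped_cover E rho : E = \bigcup_i (ifs_map lambda d i @` E) ->
  0 < rho -> forall x, E x -> exists2 p, stopped rho p & (homothety p @` E) x.
Proof.
move=> EE rho0.
have [b [b0 b1 lb]] : exists b : R, [/\ 0 < b, b < 1 & forall i, lambda i <= b].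
  exists (\big[Num.max/2^-1]_i lambda i); split.
  - by apply: lt_le_trans (bigmax_ge_id _ _ _ _).
  - by apply/bigmax_ltP; split=> [|i _]; [lra|have /andP[] := hlambda i].
  - by move=> i; exact: le_bigmax.
have [k] : exists k, b ^+ k <= rho.
  have := @cvg_expr R b; rewrite ger0_norm ?ltW// => /(_ b1)/cvgrPdist_le.
  move=> /(_ _ rho0)[k _ /(_ k (leqnn k))]; rewrite sub0r normrN => h.
  by exists k; apply: le_trans (ler_norm _) h.
elim: k rho rho0 => [|k IH] rho rho0 bk x Ex.
  exists (1, 0); first exact: stopped_id.
  by exists x => //; rewrite homothety_id.
have [rho1|rho1] := leP 1 rho.
  exists (1, 0); first exact: stopped_id.
  by exists x => //; rewrite homothety_id.
move: Ex; rewrite EE => -[i _ [y Ey <-]].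
have [] := IH (rho / lambda i) _ _ y Ey; first by rewrite divr_gt0.
  rewrite ler_pdivlMr//; apply: le_trans bk.
  by rewrite exprSr ler_pM2l ?exprn_gt0.
move=> p sp [z Ez zy].
exists (lambda i * p.1, lambda i *: p.2 + d i); first exact: stopped_comp.
by exists z; rewrite -?EE// homothety_comp zy.
Qed.

Lemma coord_le_norm (x : 'rV[R]_m) j : `|x 0 j| <= `|x|.
Proof.
rewrite /Num.norm/= mx_normrE.
exact: (le_bigmax _ (fun ij => `|x ij.1 ij.2|) (0, j)).
Qed.

(** A packing argument without volumes.  Let [V] contain a ball of centre [z0]
and radius [r0].  The stopped cylinders meeting [ball u rho] send [z0] to points
at distance less than [rho * K] from [u], and any two of these points are at
distance at least [rho * a * r0], since otherwise one of them would lie in both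
copies of [V].  So the points fall into distinct cells of a grid of mesh
[rho * a * r0], and the number of cells does not depend on [rho]. *)
Lemma ball_meets_boundedly_many E :
  is_attractor lambda d E -> open_set_condition lambda d ->
  exists N : nat, forall rho u, 0 < rho <= 1 ->
    exists F : nat -> R * 'rV[R]_m, (forall k, 0 < (F k).1 <= rho) /\
      E `&` ball u rho `<=` \bigcup_(k in `I_N) (homothety (F k) @` E).
Proof.
move=> [E0 cE EE] [V [[z0 Vz0] oV VV Vtriv]].
have /nbhs_ballP[r0 /= r00 zV] : nbhs z0 V by apply: open_nbhs_nbhs.
have [a [a0 a1 al]] : exists a : R, [/\ 0 < a, a <= 1 & forall i, a <= lambda i].
  exists (\big[Num.min/1]_i lambda i); split.
  - by apply/bigmin_gtP; split.
  - exact: bigmin_le_id.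
  - by move=> i; exact: bigmin_le.
have [D D0 DE] : exists2 D : R, 0 < D &
    forall e, E e -> forall j, `|z0 0 j - e 0 j| <= D.
  have [M /= M0 ME] := pinfty_ex_gt0 (compact_bounded cE).
  exists (`|z0| + M); first by rewrite ltr_wpDl.
  move=> e Ee j; apply: le_trans (ler_normB _ _) _.
  by apply: lerD; [exact: coord_le_norm|apply: le_trans (coord_le_norm _ _) (ME _ Ee)].
pose K := D + 1; pose g := a * r0.
have g0 : 0 < g by rewrite mulr_gt0.
pose M := (Num.trunc (2 * K / g)).+1.
pose cell rho (u : 'rV[R]_m) p : {ffun 'I_m -> 'I_M} :=
  [ffun j => inord (Num.trunc ((homothety p z0 0 j - u 0 j + rho * K) / (rho * g)))].
exists #|{: {ffun 'I_m -> 'I_M}}| => rho u /andP[rho0 rho1].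
pose meets p := stopped rho p /\ (homothety p @` E) `&` ball u rho !=set0.
have center p j : meets p -> `|homothety p z0 0 j - u 0 j| < rho * K.
  move=> [sp [_ [[e Ee <-] /(rV_ballP _ _ rho0)/(_ j) ue]]].
  rewrite -(subrKA (homothety p e 0 j)).
  apply: le_lt_trans (ler_normD _ _) _; rewrite /K mulrDr mulr1.
  apply: ler_ltD; last by rewrite distrC.
  have -> : homothety p z0 0 j - homothety p e 0 j = p.1 * (z0 0 j - e 0 j).
    by rewrite !mxE opprD addrACA subrr addr0 mulrBr.
  rewrite normrM gtr0_norm ?(stopped_gt0 sp)//.
  by apply: ler_pM; rewrite ?(stopped_le sp) ?DE// ltW// (stopped_gt0 sp).
have celljj p j : meets p -> exists2 n : nat, (n < M)%N &
    n%:R <= (homothety p z0 0 j - u 0 j + rho * K) / (rho * g) < n.+1%:R /\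
    cell rho u p j = n :> nat.
  move=> /(center _ j); rewrite ltr_norml => /andP[c1 c2].
  pose y := (homothety p z0 0 j - u 0 j + rho * K) / (rho * g); rewrite -/y.
  have y0 : 0 <= y.
    by rewrite /y divr_ge0 ?mulr_ge0 ?ltW//; lra.
  have yM : (Num.trunc y < M)%N.
    rewrite ltnS /M; apply: le_truncn.
    rewrite /y ler_pdivrMr ?mulr_gt0// [rho * g]mulrC mulrA divfK ?gt_eqF//.
    by lra.
  exists (Num.trunc y) => //; split; first exact: truncn_itv.
  by rewrite ffunE inordK.
have cell_inj p q : meets p -> meets q -> cell rho u p = cell rho u q -> p = q.
  move=> mp mq pq; have [sp _] := mp; have [sq _] := mq.
  have p0 := stopped_gt0 sp.
  apply: (stopped_disjoint (z := homothety q z0) VV Vtriv sp sq); last by exists z0.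
  exists (z0 + p.1^-1 *: (homothety q z0 - homothety p z0)); last first.
    rewrite {1}/homothety scalerDr scalerA divff ?gt_eqF// scale1r.
    by rewrite addrAC -/(homothety p z0) addrC subrK.
  apply: zV; apply/rV_ballP => // j; rewrite !mxE opprD addrA subrr sub0r normrN.
  rewrite normrM normfV (gtr0_norm p0) ltr_pdivrMl//.
  have [n nM [/andP[pn1 pn2] pn]] := celljj p j mp.
  have [n' nM' [/andP[qn1 qn2] qn]] := celljj q j mq.
  have nn' : n = n' by rewrite -pn -qn pq.
  rewrite -nn' in qn1 qn2.
  have rg0 : 0 < rho * g by rewrite mulr_gt0.
  move: pn1 pn2 qn1 qn2; rewrite !ler_pdivlMr// !ltr_pdivrMr//.
  rewrite -natr1 mulrDl mul1r => pn1 pn2 qn1 qn2.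
  have : `|homothety q z0 0 j - homothety p z0 0 j| < rho * g.
    by rewrite ltr_norml; apply/andP; split; lra.
  rewrite !mxE => /lt_le_trans; apply.
  rewrite /g mulrA ler_pM2r// mulrC; apply: (stopped_ge a0 al sp).
  by rewrite mulr_ile1// ltW.
have [F FP] : {F : nat -> R * 'rV[R]_m & forall k, 0 < (F k).1 <= rho /\
    forall p, meets p -> enum_rank (cell rho u p) = k :> nat -> F k = p}.
  apply: (@choice _ _ (fun k f => 0 < f.1 <= rho /\
    forall p, meets p -> enum_rank (cell rho u p) = k :> nat -> f = p)) => k.
  have [[p [mp pk]]|nop] := pselect (exists p, meets p /\
      enum_rank (cell rho u p) = k :> nat).
    exists p; split; first by have [sp _] := mp; rewrite (stopped_gt0 sp) (stopped_le sp).
    move=> q mq qk; apply: cell_inj => //.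
    by apply: enum_rank_inj; apply: val_inj => /=; rewrite pk qk.
  (* No cylinder has its centre in this cell: any homothety of ratio at most
     [rho] will do. *)
  exists (rho, 0); split; first by rewrite /= rho0 lexx.
  by move=> p mp pk; exfalso; apply: nop; exists p.
exists F; split; first by move=> k; have [] := FP k.
move=> x [Ex ux]; have [p sp pEx] := stopped_cover EE rho0 Ex.
have mp : meets p by split => //; exists x.
exists (enum_rank (cell rho u p)); first exact: ltn_ord.
by have [_ /(_ _ mp erefl) ->] := FP (enum_rank (cell rho u p)).
Qed.

End StoppedCylinders.

(** * Projection to a line *)
Section LineProjection.
Context {R : realType} {n : nat}.
Implicit Types (theta : 'rV[R]_n) (x y u : 'rV[R]_n.+1).

Lemma line_proj_homothety theta (p : R * 'rV[R]_n.+1) x :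
  line_proj theta (homothety p x) = p.1 * line_proj theta x + line_proj theta p.2.
Proof.
rewrite /line_proj /dotp mulr_sumr -big_split/=; apply: eq_bigr => i _.
have -> : homothety p x 0 i = p.1 * x 0 i + p.2 0 i by rewrite !mxE.
by rewrite mulrDl mulrA.
Qed.

Lemma line_proj_ball theta : exists2 c : R, 0 < c &
  forall u x rho, 0 < rho -> ball u rho x ->
    ball (line_proj theta u) (c * rho) (line_proj theta x).
Proof.
exists (1 + \sum_i `|direction theta 0 i|).
  by rewrite ltr_pwDl// sumr_ge0.
move=> u x rho rho0 /(rV_ballP _ _ rho0) ux; rewrite -ball_normE/=.
rewrite /line_proj /dotp -sumrB.
apply: le_lt_trans (ler_norm_sum _ _ _) _.
apply: (@le_lt_trans _ _ (\sum_i `|direction theta 0 i| * rho)).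
  apply: ler_sum => i _; rewrite -mulrBl normrM mulrC.
  by apply: ler_wpM2l => //; rewrite ltW.
by rewrite -mulr_suml mulrDl mul1r ltrDr.
Qed.

Lemma continuous_line_proj theta : continuous (line_proj theta).
Proof.
move=> x; have [c c0 cP] := line_proj_ball theta.
apply/(cvg_ballP (FF := nbhs_filter x)) => e e0.
apply/nbhs_ballP; exists (e / c); first exact: divr_gt0.
move=> y xy; have -> : e = c * (e / c) by rewrite mulrCA divff ?mulr1// gt_eqF.
by apply: cP => //; exact: divr_gt0.
Qed.

Lemma compact_line_proj theta (A : set 'rV[R]_n.+1) :
  compact A -> compact (line_proj theta @` A).
Proof.
move=> cA; apply: continuous_compact => //.
by apply: continuous_subspaceT; exact: continuous_line_proj.
Qed.

Lemma closed_line_proj theta (A : set 'rV[R]_n.+1) :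
  compact A -> closed (line_proj theta @` A).
Proof. by move=> cA; apply: compact_closed; [exact: Rhausdorff|exact: compact_line_proj]. Qed.

End LineProjection.

(** * Projections of sets of dimension less than one *)
Section Projection.
Context {R : realType} {n : nat}.
Variables (E : set 'rV[R]_n.+1) (theta : 'rV[R]_n).

(** For radii at most [1] and [t <= 1] one has [rho <= rho^t], so the lengths of
the projected balls add up to at most a constant times [e]. *)
Lemma hausdorff_null_line_proj (t : R) : 0 <= t <= 1 ->
  hausdorff_measure t E = 0%E ->
  measurable (line_proj theta @` E : set (measurableTypeR R)) ->
  lebesgue_measure (line_proj theta @` E : set (measurableTypeR R)) = 0%E.
Proof.
move=> /andP[t0 t1] E0 mpE.
have [t00|tn0] := eqVneq t 0.
  by move: E0; rewrite t00 => /hausdorff_measure_exp0_eq0 ->; rewrite image_set0 measure0.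
have {tn0}t0 : 0 < t by rewrite lt_neqAle eq_sym tn0.
have [c c0 cP] := line_proj_ball theta.
apply/eqP; rewrite eq_le measure_ge0 andbT; apply/lee_addgt0Pr => e e0.
have [u [rho [rho01 Eu sumrho]]] :=
  hausdorff_null_ball_cover t0 E0 (divr_gt0 e0 (mulr_gt0 c0 (ltr0n _ 2))).
pose B k : set (measurableTypeR R) := ball (line_proj theta (u k)) (c * rho k).
apply: (@le_trans _ _ (\sum_(0 <= k <oo) lebesgue_measure (B k))%E).
  apply: measure_sigma_subadditive => //.
    by move=> k; exact: measurable_realfun.measurable_ball.
  move=> _ [x /Eu[k _ ukx] <-]; exists k => //.
  by apply: cP => //; have /andP[] := rho01 k.
have rho0 k : 0 < rho k by have /andP[] := rho01 k.
apply: (@le_trans _ _ (\sum_(0 <= k <oo) ((c * 2)%:E * (rho k `^ t)%:E))%E).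
  apply: lee_nneseries => k _; first by move=> _; exact: measure_ge0.
  rewrite (lebesgue_measure_ball _ (mulr_ge0 (ltW c0) (ltW (rho0 k)))) -EFinM lee_fin.
  rewrite -[_ *+ 2]mulr_natr mulrAC; apply: ler_wpM2l; first by rewrite mulr_ge0// ltW.
  exact: ger1_powR.
rewrite nneseriesZl; last by move=> k _; rewrite lee_fin powR_ge0.
rewrite add0e.
have -> : e%:E = ((c * 2)%:E * (e / (c * 2))%:E)%E.
  by rewrite -EFinM mulrCA divff ?mulr1// gt_eqF// mulr_gt0.
by apply: lee_wpmul2l => //; rewrite lee_fin mulr_ge0// ltW.
Qed.

End Projection.

(** * Strips around a null slice *)
Section ThinSlices.
Context {R : realType} {n l : nat}.
Variables (lambda : 'I_l -> R) (d : 'I_l -> 'rV[R]_n.+1).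
Variables (E : set 'rV[R]_n.+1) (s M : R) (theta : 'rV[R]_n).
Hypothesis hlambda : forall i, 0 < lambda i < 1.
Hypothesis hE : is_attractor lambda d E.
Hypothesis hosc : open_set_condition lambda d.
Hypothesis s1 : 1 <= s.
Hypothesis M0 : 0 <= M.
Hypothesis nuM : forall x r, 0 < r ->
  (proj_measure s E theta (ball x r) <= (M * r)%:E)%E.

Local Notation nu := (hausdorff_measure s).
Let proj := line_proj theta.

(** Pulled back by the homothety, the strip over [ball x r] becomes the strip
over a ball of radius [r / p.1]; the exponent of [p.1] is [s] from the scaling
of the measure and [-1] from this radius. *)
Lemma hausdorff_strip_homothety_le (p : R * 'rV[R]_n.+1) rho x r :
  0 < p.1 <= rho -> 0 < r ->
  (nu ((homothety p @` E) `&` proj @^-1` ball x r) <=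
    (rho `^ (s - 1) * M * r)%:E)%E.
Proof.
move=> /andP[p0 prho] r0.
pose x' := (x - proj p.2) / p.1; pose r' := r / p.1.
have r'0 : 0 < r' by exact: divr_gt0.
have sub : (homothety p @` E) `&` proj @^-1` ball x r `<=`
    homothety p @` (E `&` proj @^-1` ball x' r').
  move=> _ [[y Ey <-]]; rewrite /= /proj line_proj_homothety -ball_normE/=.
  move=> xy; exists y => //; split => //; rewrite /= /ball/= /x' /r'.
  rewrite -/proj in xy *.
  have -> : (x - proj p.2) / p.1 - proj y =
      (x - (p.1 * proj y + proj p.2)) / p.1.
    by field; rewrite gt_eqF.
  by rewrite normrM normfV (gtr0_norm p0) ltr_pM2r ?invr_gt0.
apply: le_trans (le_hausdorff_measure s sub) _.
apply: le_trans (hausdorff_measure_homothety_le _ p0 (le_trans ler01 s1)) _.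
apply: (@le_trans _ _ ((p.1 `^ s)%:E * (M * r')%:E)%E).
  by apply: lee_wpmul2l; [rewrite lee_fin powR_ge0|exact: nuM].
rewrite -EFinM lee_fin.
have -> : p.1 `^ s * (M * r') = p.1 `^ (s - 1) * M * r.
  rewrite powRB ?powRr1 ?(ltW p0)// ?(gt_eqF p0) ?implybT//.
  rewrite /r' !mulrA; lra.
do 2 (apply: ler_wpM2r; first by rewrite ?(ltW r0)).
by apply: ge0_ler_powR; rewrite ?nnegrE ?subr_ge0// ltW// (lt_le_trans p0).
Qed.

Lemma hausdorff_ball_strip_le : exists2 C : R, 0 <= C &
  forall rho u x r, 0 < rho <= 1 -> 0 < r ->
  (nu (E `&` ball u rho `&` proj @^-1` ball x r) <=
    (C * r)%:E * (rho `^ (s - 1))%:E)%E.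
Proof.
have [N NP] := ball_meets_boundedly_many hlambda hE hosc.
exists (N%:R * M); first by rewrite mulr_ge0.
move=> rho u x r rho01 r0; have [F [F01 EF]] := NP rho u rho01.
pose G k := (homothety (F k) @` E) `&` proj @^-1` ball x r.
apply: (@le_trans _ _ (nu (\big[setU/set0]_(k < N) G k))).
  apply: le_hausdorff_measure; rewrite -bigcup_mkord.
  by move=> y [/EF[k Nk Fky] xy]; exists k.
apply: le_trans (outer_measure_subadditive _ G N) _.
apply: (@le_trans _ _ (\sum_(k < N) (rho `^ (s - 1) * M * r)%:E)%E).
  by apply: lee_sum => k _; exact: hausdorff_strip_homothety_le.
rewrite sumEFin sumr_const card_ord -EFinM lee_fin -mulr_natl.
by rewrite le_eqVlt; apply/orP; left; apply/eqP; lra.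
Qed.

(** The part of [E] outside an open cover of the slice is compact, so its
projection is closed and stays away from [x]: all nearby slices are covered by
the same balls. *)
Lemma null_slice_small_ratio x : (proj @` E) x ->
  hausdorff_measure (s - 1) (slice E theta x) = 0%E ->
  forall e, 0 < e -> exists2 r0, 0 < r0 & forall r, 0 < r < r0 ->
    (proj_measure s E theta (ball x r) <= (e * r)%:E)%E.
Proof.
move=> Ex Hx e e0.
(* If [s = 1], a null slice is empty, and the slice over a point of the
   projection is not. *)
have s1' : 0 < s - 1.
  rewrite lt_neqAle subr_ge0 s1 andbT eq_sym; apply/eqP => s10.
  move: Hx; rewrite s10 => /hausdorff_measure_exp0_eq0 sx0.
  by case: Ex => y Ey yx; have : set0 y by rewrite -sx0; split.
have [C C0 CP] := hausdorff_ball_strip_le.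
have C10 : 0 < C + 1 by rewrite ltr_wpDl.
have [u [rho [rho01 Eu sumrho]]] :=
  hausdorff_null_ball_cover s1' Hx (divr_gt0 e0 C10).
pose W := \bigcup_k ball (u k) (rho k).
have oW : open W by apply: bigcup_open => k _; exact: ball_open.
have cEW : compact (E `&` ~` W).
  by apply: compact_closedI; [case: hE|exact: open_closedC].
have nx : ~ (proj @` (E `&` ~` W)) x.
  by move=> [y [Ey nWy] yx]; apply/nWy/Eu; split.
have : nbhs x (~` (proj @` (E `&` ~` W))).
  apply: open_nbhs_nbhs; split => //; apply: closed_openC.
  exact: closed_line_proj.
move=> /nbhs_ballP[r0 /= r00 r0P]; exists r0 => // r /andP[rgt0 rr0].
rewrite /proj_measure /hausdorff_restr.
pose G k := E `&` ball (u k) (rho k) `&` proj @^-1` ball x r.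
apply: (@le_trans _ _ (nu (\bigcup_k G k))).
  apply: le_hausdorff_measure => y [Ey xy].
  have /existsNP : ~ (forall k, ~ ball (u k) (rho k) y).
    move=> nW; apply: (r0P (proj y)); first exact: le_ball (ltW rr0) _ xy.
    by exists y => //; split => // -[k _]; exact: nW.
  by move=> [k /contrapT uky]; exists k.
apply: le_trans (outer_measure_sigma_subadditive _ G) _.
apply: (@le_trans _ _
    (\sum_(0 <= k <oo) ((C * r)%:E * (rho k `^ (s - 1))%:E))%E).
  by apply: lee_nneseries => k _; [by move=> _; exact: outer_measure_ge0|exact: CP].
rewrite nneseriesZl; last by move=> k _; rewrite lee_fin powR_ge0.
apply: (@le_trans _ _ ((C * r)%:E * (e / (C + 1))%:E)%E).
  by apply: lee_wpmul2l => //; rewrite lee_fin mulr_ge0// ltW.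
rewrite -EFinM lee_fin mulrA ler_pdivrMr//.
by have := mulr_gt0 e0 rgt0; lra.
Qed.

End ThinSlices.

(** * Densities at Lebesgue points *)
Section Density.
Context {R : realType}.
Local Notation leb := (@lebesgue_measure R).
Implicit Types (f : measurableTypeR R -> R) (x : measurableTypeR R).

Lemma integral_le_ess_sup f : measurable_fun setT f -> (forall x, 0 <= f x) ->
  (ess_sup leb (EFin \o f) < +oo)%E ->
  exists2 M : R, 0 <= M & forall B : set (measurableTypeR R), measurable B ->
    (\int[leb]_(x in B) (f x)%:E <= M%:E * leb B)%E.
Proof.
move=> mf f0 fsup.
have [M M0 fM] : exists2 M : R, 0 <= M & (ess_sup leb (EFin \o f) <= M%:E)%E.
  case: (ess_sup _ _) fsup => [r _|//|_]; last by exists 0 => //; exact: leNye.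
  by exists (Num.max 0 r); rewrite ?lee_fin le_max lexx ?orbT.
exists M => // B mB; rewrite -integral_cst//.
apply: ae_ge0_le_integral => //=.
- by move=> x _; rewrite lee_fin.
- apply/measurable_EFinP; exact: measurable_funTS.
- by move/ess_supP: fM; apply: filterS => x fx _; exact: fx.
Qed.

(** On a small ball the mean of [f] is at most [f x / 4] and the mean of
[`|f - f x|] less than [f x / 2], while their sum is at least [f x]. *)
Lemma lebesgue_pt_eq0 f x : measurable_fun setT f -> (forall y, 0 <= f y) ->
  lebesgue_pt f x ->
  (forall e, 0 < e -> exists2 r0, 0 < r0 & forall r, 0 < r < r0 ->
    (\int[leb]_(y in ball x r) (f y)%:E <= (e * r)%:E)%E) ->
  f x = 0.
Proof.
move=> mf f0 fx small; apply/eqP/negP => /negP fx0.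
have {fx0}fx0 : 0 < f x by rewrite lt_neqAle eq_sym fx0 f0.
have e0 : 0 < f x / 2 by rewrite divr_gt0.
have [r0 r00 r0P] := small _ e0.
have ndavg : \forall r \near 0^'+, (davg f x r < (f x / 2)%:E)%E.
  move: fx => /fine_cvgP[fin /cvgrPdist_lt/(_ _ e0) h].
  near=> r.
  have fr : davg f x r \is a fin_num by near: r.
  rewrite -(fineK fr) lte_fin; apply: le_lt_trans (ler_norm _) _.
  by rewrite -normrN -[X in `|X|]sub0r; near: r.
have [r [r0' rr0 dr]] : exists r, [/\ 0 < r, r < r0 & (davg f x r < (f x / 2)%:E)%E].
  near (0:R)^'+ => r; exists r; split; near: r => //.
    exact: nbhs_right_gt.
  exact: nbhs_right_lt.
have mB : measurable (ball x r : set (measurableTypeR R)).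
  exact: measurable_ball.
have lebB : leb (ball x r) = (r *+ 2)%:E.
  by rewrite lebesgue_measure_ball// ltW.
have r2 : 0 < r *+ 2 by rewrite mulrn_wgt0.
have mfB : measurable_fun (ball x r : set (measurableTypeR R)) f.
  exact: measurable_funTS.
have mnB : measurable_fun (ball x r : set (measurableTypeR R))
    (fun y => `|f y - f x|%:E).
  apply/measurable_EFinP; apply: measurableT_comp => //.
  exact: measurable_funB.
have dint : (\int[leb]_(y in ball x r) `|f y - f x|%:E <= (f x / 2 * (r *+ 2))%:E)%E.
  move: dr; rewrite /davg /iavg lebB inver gt_eqF// lte_pdivrMl//= => /ltW.
  by rewrite -EFinM mulrC.
have : ((f x * (r *+ 2))%:E <= (f x / 2 * r)%:E + (f x / 2 * (r *+ 2))%:E)%E.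
  rewrite EFinM -lebB -integral_cst//.
  apply: (@le_trans _ _ (\int[leb]_(y in ball x r) ((f y)%:E + `|f y - f x|%:E))%E).
    apply: ge0_le_integral => //=.
    - by move=> y _; rewrite lee_fin.
    - apply: emeasurable_funD => //; exact/measurable_EFinP.
    - move=> y _; rewrite -EFinD lee_fin.
      by have := ler_norm (f x - f y); rewrite distrC; lra.
  rewrite ge0_integralD//=.
  - apply: leeD => //.
    by apply: r0P; rewrite r0'.
  - by move=> y _; rewrite lee_fin.
  - exact/measurable_EFinP.
rewrite -EFinD lee_fin -mulr_natr.
by have := mulr_gt0 fx0 r0'; lra.
Unshelve. all: by end_near. Qed.

End Density.

(** * Positivity of almost every slice *)
Theorem theorem6p1 (R : realType) (n l : nat)
    (lambda : 'I_l -> R) (d : 'I_l -> 'rV[R]_n.+1)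
    (E : set 'rV[R]_n.+1) (s : R) (theta : 'rV[R]_n)
    (hlambda : forall i, 0 < lambda i < 1)
    (hE : is_attractor lambda d E)
    (hosc : open_set_condition lambda d)
    (hslice : slice_coding_condition lambda d E)
    (hs : hausdorff_dim E = s%:E)
    (hac : proj_measure s E theta `<< lebesgue_measure)
    (hdens : has_bounded_density (proj_measure s E theta)) :
  {ae proj_measure s E theta, forall x, (line_proj theta @` E) x ->
    (0 < hausdorff_measure (s - 1) (slice E theta x))%E}.
Proof.
have [f [mf f0 fsup nuE]] := hdens.
have [M M0 fM] := integral_le_ess_sup mf f0 fsup.
have [E0 cE EE] := hE.
have mpE : measurable (line_proj theta @` E : set (measurableTypeR R)).
  by apply: closed_measurable; exact: closed_line_proj.
have [s1|s1] := ltP s 1.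
  have : (hausdorff_dim E < 1%:E)%E by rewrite hs lte_fin.
  move=> /ereal_inf_lt[_ [t [t0 Et] <-]]; rewrite lte_fin => t1.
  exists (line_proj theta @` E); split => //; last first.
    by move=> x /= /not_implyP[].
  rewrite nuE//; apply/eqP; rewrite eq_le; apply/andP; split; last first.
    by apply: integral_ge0 => x _; rewrite lee_fin.
  apply: le_trans (fM _ mpE) _.
  by rewrite (hausdorff_null_line_proj (t := t))// ?mule0// t0 ltW.
have nuM x r : 0 < r -> (proj_measure s E theta (ball x r) <= (M * 2 * r)%:E)%E.
  move=> r0; have mB : measurable (ball x r : set (measurableTypeR R)).
    exact: measurable_ball.
  rewrite nuE//; apply: le_trans (fM _ mB) _.
  by rewrite (lebesgue_measure_ball _ (ltW r0)) -EFinM lee_fin -mulr_natr; lra.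
have locf : locally_integrable setT f.
  split=> //; first exact: openT.
  move=> K _ cK; have mK : measurable (K : set (measurableTypeR R)).
    exact: compact_measurable.
  under eq_integral => y _ do rewrite ger0_norm//.
  apply: le_lt_trans (fM _ mK) _.
  rewrite lte_mul_pinfty ?lee_fin//.
  exact: compact_finite_measure.
have [N [mN N0 NP]] := lebesgue_differentiation locf.
pose Z : set (measurableTypeR R) := N `|` f @^-1` [set 0].
have mZ : measurable Z.
  apply: measurableU => //; rewrite -[X in measurable X]setTI.
  exact: mf.
exists Z; split => //.
  rewrite nuE// -(integral0 lebesgue_measure Z); apply: ae_eq_integral => //.
    apply/measurable_EFinP; exact: measurable_funTS.
  exists N; split => // x /=; apply: contra_notP => Nx [//|fx0].
  by rewrite fx0.
move=> x /= /not_implyP[Ex /negP]; rewrite -leNgt => Hx.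
have {}Hx : hausdorff_measure (s - 1) (slice E theta x) = 0%E.
  by apply/eqP; rewrite eq_le Hx hausdorff_measure_ge0.
have [Nx|Nx] := pselect (N x); [by left|right].
apply: lebesgue_pt_eq0 => //.
  by apply: contra_notP Nx => nx; exact: NP.
move=> e e0; have [r0 r00 r0P] :=
  null_slice_small_ratio hlambda hE hosc s1 (mulr_ge0 M0 (ler0n _ 2)) nuM Ex Hx e0.
exists r0 => // r rr0; rewrite -nuE; first exact: r0P.
exact: measurable_ball.
Qed.
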